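(* Let $\Gamma$ be a graph, let $G$ be a group of automorphisms of $\Gamma$ acting transitively on $V\Gamma$, and let $\mathcal{B}$ be a $G$-invariant partition of $V\Gamma$ such that each $B\in\mathcal{B}$ consists of pairwise non-adjacent vertices of $\Gamma$. Suppose that $(\Gamma_{\mathcal{B}},\mathcal{Q})$ is a $G^{\mathcal{B}}$-transitive decomposition. For each $Q\in\mathcal{Q}$ define $$P_Q=\{\{\alpha,\beta\}\in E\Gamma \mid \text{there is } \{B_i,B_j\}\in Q \text{ with } \alpha\in B_i \text{ and } \beta\in B_j\},$$ and let $\mathcal{P}=\{P_Q\mid Q\in\mathcal{Q}\}$. Then $(\Gamma,\mathcal{P})$ is a $G$-transitive decomposition.
   Context: Graphs are simple and undirected; $V\Gamma$ and $E\Gamma$ denote the vertex set and edge set of $\Gamma$, an edge being an unordered pair of distinct vertices. For a graph $\Gamma$, a group $G$ of automorphisms of $\Gamma$ (a group of permutations of $V\Gamma$ leaving $E\Gamma$ invariant) and a partition $\mathcal{P}$ of $E\Gamma$ (into nonempty parts), the pair $(\Gamma,\mathcal{P})$ is called a $G$-transitive decomposition if (1) for every $P\in\mathcal{P}$ and $g\in G$, the image $P^g$ is again a part in $\mathcal{P}$ (possibly $P$ itself), and (2) for all $P,P'\in\mathcal{P}$ there exists $g\in G$ with $P^g=P'$. A partition $\mathcal{B}$ of $V\Gamma$ is $G$-invariant if $B^g\in\mathcal{B}$ for all $B\in\mathcal{B}$ and $g\in G$; then $G$ permutes the elements of $\mathcal{B}$, and $G^{\mathcal{B}}$ denotes the group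 of permutations of $\mathcal{B}$ induced by this action. The imprimitive quotient $\Gamma_{\mathcal{B}}$ is the graph with vertex set $\mathcal{B}$ in which distinct $B_1,B_2\in\mathcal{B}$ form an edge $\{B_1,B_2\}$ whenever there exist $\alpha\in B_1$ and $\beta\in B_2$ with $\{\alpha,\beta\}\in E\Gamma$. *)

(* Defs.v *)
From mathcomp Require Import all_boot.
From mathcomp Require Export boolp classical_sets.

Set Implicit Arguments.
Unset Strict Implicit.
Unset Printing Implicit Defensive.

Local Open Scope classical_set_scope.

(* The vertex set is the whole type V, which may be infinite or empty. *)
Record graph (V : Type) := Graph {
  edges : set (set V);
  edgesP : forall e, edges e -> exists a b : V, a <> b /\ e = [set a; b]
}.

Definition is_partition (T : Type) (P : set (set T)) (A : set T) : Prop :=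
  partition P id A.

Definition perm_group (V : Type) (G : set (V -> V)) : Prop :=
  [/\ forall g, G g -> bijective g,
      G id,
      forall g h, G g -> G h -> G (g \o h) &
      forall g, G g -> exists h, [/\ G h, cancel g h & cancel h g]].

Definition image_edges (V : Type) (g : V -> V) (P : set (set V)) : set (set V) :=
  [set g @` e | e in P].

Definition aut_group (V : Type) (Gam : graph V) (G : set (V -> V)) : Prop :=
  perm_group G /\ forall g, G g -> image_edges g (edges Gam) = edges Gam.

Definition vertex_transitive (V : Type) (G : set (V -> V)) : Prop :=
  forall x y : V, exists2 g, G g & g x = y.

Definition transitive_decomposition (V : Type) (G : set (V -> V))
    (Gam : graph V) (P : set (set (set V))) : Prop :=
  [/\ aut_group Gam G,
      is_partition P (edges Gam),
      forall p g, P p -> G g -> P (image_edges g p) &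
      forall p p', P p -> P p' -> exists2 g, G g & image_edges g p = p'].

Definition invariant_partition (V : Type) (G : set (V -> V))
    (BB : set (set V)) : Prop :=
  is_partition BB [set: V] /\ forall B g, BB B -> G g -> BB (g @` B).

Definition independent (V : Type) (Gam : graph V) (B : set V) : Prop :=
  forall a b, B a -> B b -> ~ edges Gam [set a; b].

(* Below, BB used as a type is the type of the members of BB, and
   val : BB -> set V is the inclusion. *)

Definition induced_group (V : Type) (G : set (V -> V)) (BB : set (set V)) :
    set (BB -> BB) :=
  [set h | exists2 g, G g & forall B : BB, val (h B) = g @` val B].

Definition quotient_edges (V : Type) (Gam : graph V) (BB : set (set V)) :
    set (set BB) :=
  [set e | exists B1 B2 : BB,
     [/\ B1 <> B2,
         exists a b, [/\ val B1 a, val B2 b & edges Gam [set a; b]] &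
         e = [set B1; B2]]].

Lemma quotient_edgesP (V : Type) (Gam : graph V) (BB : set (set V)) e :
  quotient_edges Gam (BB:=BB) e ->
  exists B1 B2 : BB, B1 <> B2 /\ e = [set B1; B2].
Proof. by move=> [B1 [B2 [B12 _ ->]]]; exists B1, B2. Qed.

Definition quotient_graph (V : Type) (Gam : graph V) (BB : set (set V)) :
    graph BB :=
  Graph (@quotient_edgesP V Gam BB).

Definition lift_part (V : Type) (Gam : graph V) (BB : set (set V))
    (Q : set (set BB)) : set (set V) :=
  [set e | edges Gam e /\
     exists (a b : V) (Bi Bj : BB),
       [/\ e = [set a; b], Q [set Bi; Bj], val Bi a & val Bj b]].

(* Main.v *)
Require Import Defs.
From mathcomp Require Import all_boot boolp classical_sets.

(** The proof rests on the map pi sending a set of vertices to the set of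
    blocks that it meets ([blocks_met]).  Independence of the blocks makes pi
    send the edges of the graph to edges of the quotient graph
    ([blocks_met_edge]), and the definition of the quotient makes it surjective
    on edges ([edge_over_quotient_edge]).  The lifted part P_Q is the preimage
    of Q under this map of edges ([lift_partE]), and the preimages of the parts
    of a partition under a surjection again form a partition.

    Moreover pi intertwines each g in G with the permutation h of the blocks
    that it induces ([blocks_met_image]).  Preimages under an equivariant map
    commute with the group action, so g sends P_Q to the lift of the image of Q
    under h ([image_lift_part]).  Invariance of the family of lifted parts and
    transitivity of G on it are then inherited from the family of the Q. *)

Set Implicit Arguments.
Unset Strict Implicit.

Local Open Scope classical_set_scope.

Lemma image_set_inj (T U : Type) (f : T -> U) :
  injective f -> injective (fun A : set T => f @` A).
Proof.
move=> f_inj A B AB; apply/funext=> x.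
by rewrite -(image_inj f_inj) AB image_inj.
Qed.

Section BlockProjection.
Variables (V : Type) (Gam : graph V) (G : set (V -> V)) (BB : set (set V)).

Definition blocks_met (e : set V) : set BB :=
  [set B | val B `&` e !=set0].

Definition induces (g : V -> V) (h : BB -> BB) : Prop :=
  forall B, val (h B) = g @` val B.

Hypothesis autG : aut_group Gam G.
Hypothesis partB : is_partition BB [set: V].
Hypothesis invB : forall B g, BB B -> G g -> BB (g @` B).
Hypothesis indepB : forall B, BB B -> independent Gam B.

Lemma block_exists a : exists B : BB, val B a.
Proof.
case: partB => cov _ _.
have [B BBB Ba] : cover BB id a by rewrite cov.
by exists (exist _ B (mem_set BBB)).
Qed.

Lemma block_unique (B C : BB) a : val B a -> val C a -> B = C.
Proof.
case: partB => _ triv _ Ba Ca; apply: val_inj.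
by apply: triv; [exact: set_valP | exact: set_valP | exists a].
Qed.

Lemma blocks_met_pair (B C : BB) a b :
  val B a -> val C b -> blocks_met [set a; b] = [set B; C].
Proof.
move=> Ba Cb; apply/seteqP; split=> D /=.
  by move=> [x [Dx]] [] xE; move: Dx; rewrite xE => Dx; [left | right];
    exact: block_unique Dx _.
by case=> ->; [exists a | exists b]; split=> //; [left | right].
Qed.

(** Independence forces the two ends of an edge into distinct blocks, so that
    the edge does not collapse to a single vertex of the quotient. *)
Lemma blocks_met_edge e :
  edges Gam e -> edges (quotient_graph Gam BB) (blocks_met e).
Proof.
move=> Ee; have [a [b [_ eab]]] := edgesP Ee; subst e.
have [B Ba] := block_exists a; have [C Cb] := block_exists b.
rewrite (blocks_met_pair Ba Cb); exists B, C; split=> //.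
  move=> BC; subst C; exact: (indepB (set_valP B) Ba Cb Ee).
by exists a, b.
Qed.

(** This surjectivity is what makes every lifted part nonempty. *)
Lemma edge_over_quotient_edge q :
  edges (quotient_graph Gam BB) q ->
  exists2 e, edges Gam e & blocks_met e = q.
Proof.
move=> [B [C [_ [a [b [Ba Cb Eab]]] ->]]].
by exists [set a; b]; rewrite // (blocks_met_pair Ba Cb).
Qed.

(** The two end vertices and the choice of their blocks disappear: the lift of
    [Q] is the preimage of [Q] under the projection of edges. *)
Lemma lift_partE Q e :
  lift_part Gam Q e <-> edges Gam e /\ Q (blocks_met e).
Proof.
split=> -[Ee].
  move=> [a [b [B [C [eab QBC Ba Cb]]]]]; split=> //.
  by rewrite eab (blocks_met_pair Ba Cb).
move=> Qe; split=> //; have [a [b [_ eab]]] := edgesP Ee; subst e.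
have [B Ba] := block_exists a; have [C Cb] := block_exists b.
by exists a, b, B, C; rewrite -(blocks_met_pair Ba Cb).
Qed.

Lemma induces_exists g : G g -> exists h, induces g h.
Proof.
move=> Gg; exists (fun B : BB =>
  exist _ (g @` val B) (mem_set (invB (set_valP B) Gg)) : BB).
by move=> B.
Qed.

(** The block containing [g x] is the image under [h] of the block containing
    [x], because blocks are disjoint. *)
Lemma blocks_met_image g h e : induces g h ->
  blocks_met (g @` e) = h @` blocks_met e.
Proof.
move=> gh; apply/seteqP; split=> B.
  move=> [y [By [x ex xy]]]; have [C Cx] := block_exists x.
  exists C; first by exists x.
  by apply: (block_unique _ By); rewrite gh; exists x.
move=> [C [x [Cx ex]] <-]; exists (g x); split; last by exists x.
by rewrite gh; exists x.
Qed.

(** One inclusion is the equivariance of the projection.  The other pulls an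
    edge back along [g], which maps the edge set onto itself, and then cancels
    [h], injective because [g] is. *)
Lemma image_lift_part g h Q : G g -> induces g h ->
  image_edges g (lift_part Gam Q) = lift_part Gam (image_edges h Q).
Proof.
move=> Gg gh; have [[bijG _ _ _] presE] := autG.
have ginj : injective g by exact/bij_inj/bijG.
have hinj : injective h.
  move=> B C /(congr1 val); rewrite !gh => /(image_set_inj ginj).
  exact: val_inj.
apply/seteqP; split=> e.
  move=> [e' /lift_partE [Ee' Qe'] <-]; apply/lift_partE; split.
    by rewrite -(presE _ Gg); exists e'.
  by rewrite (blocks_met_image _ gh); exists (blocks_met e').
move=> /lift_partE [+ Qe]; rewrite -{1}(presE _ Gg) => -[e' Ee' e'e].
exists e' => //; apply/lift_partE; split=> //.
move: Qe; rewrite -e'e (blocks_met_image _ gh).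
by move=> [q Qq /(image_set_inj hinj) <-].
Qed.

End BlockProjection.

Theorem lemma3p1 (V : Type) (Gam : graph V) (G : set (V -> V))
    (BB : set (set V)) (QQ : set (set (set BB))) :
  aut_group Gam G ->
  vertex_transitive G ->
  invariant_partition G BB ->
  (forall B, BB B -> independent Gam B) ->
  transitive_decomposition (@induced_group V G BB) (quotient_graph Gam BB) QQ ->
  transitive_decomposition G Gam [set lift_part Gam Q | Q in QQ].
Proof.
move=> autG _ [partB invB] indepB [_ [covQ trivQ neQ] invQ transQ].
split=> //; first split.
- apply/seteqP; split=> e.
    by move=> [_ [Q _ <-] [Ee _]].
  move=> Ee; have := blocks_met_edge partB indepB Ee.
  rewrite -covQ => -[Q QQQ Qe]; exists (lift_part Gam Q); first by exists Q.
  by apply/(lift_partE Gam partB).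
- move=> _ _ [Q QQQ <-] [Q' QQQ' <-] [e [Pe Pe']].
  have [_ Qe] := (lift_partE Gam partB _ _).1 Pe.
  have [_ Qe'] := (lift_partE Gam partB _ _).1 Pe'.
  by congr (lift_part Gam _); apply: trivQ => //; exists (blocks_met e).
- move=> _ [Q QQQ <-]; have [q Qq] := neQ Q QQQ.
  have : edges (quotient_graph Gam BB) q by rewrite -covQ; exists Q.
  move=> /(edge_over_quotient_edge partB) [e Ee eq].
  by exists e; apply/(lift_partE Gam partB); rewrite eq.
- move=> _ g [Q QQQ <-] Gg; have [h gh] := induces_exists invB Gg.
  rewrite (image_lift_part autG partB _ Gg gh).
  by exists (image_edges h Q) => //; apply: invQ => //; exists g.
- move=> _ _ [Q QQQ <-] [Q' QQQ' <-].
  have [h [g Gg gh] <-] := transQ Q Q' QQQ QQQ'.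
  by exists g => //; exact: (image_lift_part autG partB _ Gg gh).
Qed.
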